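(* Fix an integer $k\geq 1$. Let $\mathbb{F}=\mathbb{C}(x_0,x_1,\ldots,x_{2k},a)$ be the field of rational functions in the independent indeterminates $x_0,\ldots,x_{2k},a$, and define $x_n\in\mathbb{F}$ for all $n\in\mathbb{Z}$ by iterating the recurrence $$x_{n+2k+1}\,x_n = x_{n+2k}\,x_{n+1}+a\,(x_{n+k}+x_{n+k+1})$$ forwards and backwards from $x_0,\ldots,x_{2k}$. Then for all $n\in\mathbb{Z}$, $$x_{n+6k}-K\,(x_{n+4k}-x_{n+2k})-x_n=0,$$ where $K=P^{(0)}+a\,P^{(1)}+a^2P^{(2)}$ with $$P^{(0)}=1+\frac{x_0}{x_{2k}}+\frac{x_{2k}}{x_0},$$ $$P^{(1)}=\Big(1+\frac{x_{2k}}{x_0}\Big)\sum_{j=1}^k\frac{x_{j-1}+x_j}{x_{j+k-1}x_{j+k}}+\Big(1+\frac{x_0}{x_{2k}}\Big)\sum_{j=1}^k\frac{x_{j+k-1}+x_{j+k}}{x_{j-1}x_j},$$ $$P^{(2)}=\frac{1}{x_kx_{2k}}+\sum_{j=0}^{k-1}\frac{1}{x_j}\Big(\frac{1}{x_{j+k}}+\frac{1}{x_{j+k+1}}\Big)+\sum_{\ell=1}^{k-1}\sum_{m=1}^{\ell}\frac{(x_\ell+x_{\ell+1})(x_{k+m-1}+x_{k+m})}{x_{k+\ell}x_{k+\ell+1}x_{m-1}x_m}.$$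
   Context: The parameter $a$ stands for a nonzero parameter; here it is treated as an indeterminate. All $x_n$ produced by the recurrence are nonzero elements of $\mathbb{F}$, so the forward and backward iteration is well defined. *)

(* Defs.v *)
From HB Require Import structures.
From mathcomp Require Import all_boot all_order all_algebra.
From mathcomp Require Import fraction complex reals.
From mathcomp Require Import mpoly.

Set Implicit Arguments.
Unset Strict Implicit.
Unset Printing Implicit Defensive.

Import Order.TTheory GRing.Theory Num.Theory.
Local Open Scope ring_scope.

(* C(x_0, ..., x_2k, a), where C = R[i]: the variables 'X_0, ..., 'X_2k are
   x_0, ..., x_2k, and the last one, of index 2k + 1, is a. *)
Notation ratF R k := {fraction {mpoly R[i][(2 * k).+2]}}.

Definition param (R : realType) (k : nat) : ratF R k :=
  tofrac ('X_ord_max : {mpoly R[i][(2 * k).+2]}).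

(* Only meaningful for i <= 2k. *)
Definition init (R : realType) (k : nat) (i : nat) : ratF R k :=
  tofrac ('X_(inord i) : {mpoly R[i][(2 * k).+2]}).

Section Iteration.

Variables (F : fieldType) (k : nat) (a : F).

(* A window (x_n, ..., x_{n+2k}) is a function s : nat -> F with s i = x_{n+i};
   only the values s i with i <= 2k matter. *)

Definition forward (s : nat -> F) : nat -> F := fun i =>
  if i == (2 * k)%N
  then (s (2 * k)%N * s 1%N + a * (s k + s k.+1)) / s 0%N
  else s i.+1.

(* The recurrence at n - 1, solved for x_{n-1}. *)
Definition backward (s : nat -> F) : nat -> F := fun i =>
  if i is j.+1 then s j
  else (s (2 * k).-1 * s 0%N + a * (s k.-1 + s k)) / s (2 * k)%N.

Definition iterates (s : nat -> F) (n : int) : F :=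
  match n with
  | Posz m => iter m forward s 0%N
  | Negz m => iter m.+1 backward s 0%N
  end.

End Iteration.

Definition xseq (R : realType) (k : nat) : int -> ratF R k :=
  iterates k (param R k) (@init R k).

Section Invariant.

Variables (F : fieldType) (k : nat) (a : F) (x : int -> F).

Definition P0 : F := 1 + x 0 / x (2 * k)%N + x (2 * k)%N / x 0.

Definition P1 : F :=
  (1 + x (2 * k)%N / x 0) *
    (\sum_(1 <= j < k.+1)
       (x (j%:Z - 1) + x j) / (x (j%:Z + k%:Z - 1) * x (j%:Z + k%:Z)))
  + (1 + x 0 / x (2 * k)%N) *
    (\sum_(1 <= j < k.+1)
       (x (j%:Z + k%:Z - 1) + x (j%:Z + k%:Z)) / (x (j%:Z - 1) * x j)).

Definition P2 : F :=
  1 / (x k * x (2 * k)%N)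
  + \sum_(0 <= j < k)
      1 / x j * (1 / x (j%:Z + k%:Z) + 1 / x (j%:Z + k%:Z + 1))
  + \sum_(1 <= l < k) \sum_(1 <= m < l.+1)
      ((x l + x (l%:Z + 1)) * (x (k%:Z + m%:Z - 1) + x (k%:Z + m%:Z)))
      / (x (k%:Z + l%:Z) * x (k%:Z + l%:Z + 1) * x (m%:Z - 1) * x m).

Definition Kinv : F := P0 + a * P1 + a ^+ 2 * P2.

End Invariant.

(* Division is total (x / 0 = 0), so the following facts are what makes xseq
   the two-sided solution of the recurrence. *)

Section Positivity.

Variables (R : realType) (m : nat).

Let ev (p : {mpoly R[i][m]}) : R[i] := p.@[fun=> 1].

Definition posfrac (f : {fraction {mpoly R[i][m]}}) : Prop :=
  exists p q : {mpoly R[i][m]}, [/\ 0 < ev p, 0 < ev q & f = tofrac p / tofrac q].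

Lemma ev_neq0 p : 0 < ev p -> tofrac p != 0.
Proof.
by rewrite tofrac_eq0; apply: contraTneq => ->; rewrite /ev meval0 ltxx.
Qed.

Lemma posfrac_neq0 f : posfrac f -> f != 0.
Proof.
by move=> [p [q [p0 q0 ->]]]; rewrite mulf_neq0 ?invr_eq0 ?ev_neq0.
Qed.

Lemma posfracD f g : posfrac f -> posfrac g -> posfrac (f + g).
Proof.
move=> [p [q [p0 q0 ->]]] [p' [q' [p'0 q'0 ->]]].
exists (p * q' + p' * q), (q * q'); split.
- by rewrite /ev mevalD !mevalM addr_gt0 ?mulr_gt0.
- by rewrite /ev mevalM mulr_gt0.
- by rewrite tofracD !tofracM addf_div ?ev_neq0.
Qed.

Lemma posfracM f g : posfrac f -> posfrac g -> posfrac (f * g).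
Proof.
move=> [p [q [p0 q0 ->]]] [p' [q' [p'0 q'0 ->]]].
exists (p * p'), (q * q'); split.
- by rewrite /ev mevalM mulr_gt0.
- by rewrite /ev mevalM mulr_gt0.
- by rewrite !tofracM mulf_div.
Qed.

Lemma posfracV f : posfrac f -> posfrac f^-1.
Proof. by move=> [p [q [p0 q0 ->]]]; exists q, p; rewrite invf_div. Qed.

Lemma posfracX i : posfrac (tofrac ('X_i : {mpoly R[i][m]})).
Proof.
exists 'X_i, 1; split; last by rewrite tofrac1 divr1.
- by rewrite /ev mevalXU ltr01.
- by rewrite /ev meval1 ltr01.
Qed.

End Positivity.

Section Solution.

Variables (R : realType) (k : nat).

Local Notation a := (param R k).
Local Notation x := (xseq R k).

Let win (n : int) : nat -> ratF R k :=
  match n with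
  | Posz m => iter m (forward k a) (@init R k)
  | Negz m => iter m.+1 (backward k a) (@init R k)
  end.

Let xseqE n : x n = win n 0%N. Proof. by case: n. Qed.

Let win_pos n i : posfrac (win n i).
Proof.
have pos_init j : posfrac (@init R k j) by exact: posfracX.
have pos_a : posfrac a by exact: posfracX.
have pos_iter f : (forall s, (forall j, posfrac (s j)) ->
    forall j, posfrac (f s j)) -> forall m j, posfrac (iter m f (@init R k) j).
  by move=> fP; elim=> [|m IHm] j //=; apply: fP.
case: n => m; apply: pos_iter => s sP [|j]; rewrite /forward /backward //.
- by case: ifP => // _; do ?[exact: sP | exact: pos_a | apply: posfracD
    | apply: posfracM | apply: posfracV].
- by case: ifP => // _; do ?[exact: sP | exact: pos_a | apply: posfracD
    | apply: posfracM | apply: posfracV].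
- by do ?[exact: sP | exact: pos_a | apply: posfracD
    | apply: posfracM | apply: posfracV].
Qed.

Lemma xseq_neq0 n : x n != 0.
Proof. by rewrite xseqE; apply/posfrac_neq0/win_pos. Qed.

Let win_negS m : win (Negz m) = backward k a (win (Negz m + 1)).
Proof.
case: m => [|m] //; suff -> : Negz m.+1 + 1 = Negz m by [].
by rewrite !NegzE -[m.+2]addn1 PoszD opprD addrNK.
Qed.

Let win_posS m : win (Posz m + 1) = forward k a (win m).
Proof. by rewrite -PoszD addn1. Qed.

Let win_shift n i : (i < 2 * k)%N -> win n i.+1 = win (n + 1) i.
Proof.
move=> ltik; case: n => m; last by rewrite win_negS.
by rewrite win_posS /forward ltn_eqF.
Qed.

Let winE n i : (i <= 2 * k)%N -> win n i = x (n + i%:Z).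
Proof.
elim: i n => [|i IHi] n lei; first by rewrite addr0 xseqE.
by rewrite win_shift // IHi 1?ltnW // -[i.+1]add1n PoszD addrA.
Qed.

Lemma xseq_init i : (i <= 2 * k)%N -> x i = @init R k i.
Proof. by move=> lei; rewrite -[Posz i]add0r -winE. Qed.

Lemma xseq_rec n : (1 <= k)%N ->
  x (n + (2 * k)%N%:Z + 1) * x n
    = x (n + (2 * k)%N%:Z) * x (n + 1)
      + a * (x (n + k%:Z) + x (n + k%:Z + 1)).
Proof.
move=> k0; have le1 : (1 <= 2 * k)%N by rewrite muln_gt0.
have lek : (k < 2 * k)%N by rewrite mul2n -addnn -addn1 leq_add2l.
case: n => m.
- have -> : x (Posz m + (2 * k)%N%:Z + 1) = win (Posz m + 1) (2 * k)%N.
    by rewrite winE // addrAC.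
  rewrite win_posS /forward eqxx -xseqE divfK ?xseq_neq0 //.
  rewrite (winE m (leqnn _)) (winE m le1) (winE m (ltnW lek)) (winE m lek).
  by rewrite -[k.+1]addn1 PoszD addrA.
- have n0 := xseq_neq0 (Negz m + (2 * k)%N%:Z + 1).
  rewrite [x (Negz m)]xseqE win_negS /backward.
  rewrite (winE (Negz m + 1) (leqnn _)) (addrAC _ 1) mulrC divfK //.
  have le2k : ((2 * k).-1 <= 2 * k)%N by exact: leq_pred.
  have lek1 : (k.-1 <= 2 * k)%N by rewrite (leq_trans (leq_pred _)) // ltnW.
  rewrite (winE _ le2k) (winE _ lek1) (winE _ (ltnW lek)) (winE _ (leq0n _)).
  rewrite addr0 -!addrA -[1 + (2 * k).-1%:Z]PoszD -[1 + k.-1%:Z]PoszD.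
  by rewrite !add1n !prednK // (addrC 1).
Qed.

End Solution.

(* Main.v *)
Require Import Defs.
From HB Require Import structures.
From mathcomp Require Import all_boot all_order all_algebra.
From mathcomp Require Import fraction complex reals.
From mathcomp Require Import mpoly.
From mathcomp Require Import zify ring.
Import GRing.Theory.
Local Open Scope ring_scope.

(** The recurrence says that the ratios x_(n+2k) / x_n and x_n / x_(n+2k) have
    increments a (x_(n+k) + x_(n+k+1)) / (x_n x_(n+1)) and
    - a (x_(n+k) + x_(n+k+1)) / (x_(n+2k) x_(n+2k+1)), so all the sums in K
    telescope.  With y_i := x_(n+ik), what remains is, at n = -k,
      K = y_0/y_2 + y_5/y_3 + (y_1 y_4 + a^2)/(y_2 y_3),
    which does not depend on n: this follows from four instances of the
    recurrence.  Clearing denominators, K y_2 y_3 and K y_3 y_4 (the same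
    expression at n + k) share the terms y_1 y_4 + y_2 y_5 + a^2, and their
    difference is the linear relation multiplied by y_3. *)

Section LinearRelation.

Variables (F : fieldType) (k : nat) (a : F) (x : int -> F).
Hypothesis x_neq0 : forall n, x n != 0.
Hypothesis x_rec : forall n : int,
  x (n + (2 * k)%N%:Z + 1) * x n
    = x (n + (2 * k)%N%:Z) * x (n + 1)
      + a * (x (n + k%:Z) + x (n + k%:Z + 1)).

Definition reducedK (n : int) : F :=
  x n / x (n + (2 * k)%N%:Z) + x (n + (5 * k)%N%:Z) / x (n + (3 * k)%N%:Z)
  + (x (n + k%:Z) * x (n + (4 * k)%N%:Z) + a ^+ 2)
    / (x (n + (2 * k)%N%:Z) * x (n + (3 * k)%N%:Z)).

(** The recurrence at n and n + 3k gives the increments of the two simple ratios; at n + k and n +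
    2k it shows that the remaining quotient changes by the opposite amount. *)
Lemma reducedK_step n : reducedK (n + 1) = reducedK n.
Proof.
rewrite /reducedK.
have e i : n + 1 + i = n + i + 1 by ring.
rewrite !e.
have h0 := x_rec n.
have h1 := x_rec (n + k%:Z).
have h2 := x_rec (n + (2 * k)%N%:Z).
have h3 := x_rec (n + (3 * k)%N%:Z).
move: h1 h2 h3.
have -> : n + k%:Z + (2 * k)%N%:Z = n + (3 * k)%N%:Z by lia.
have -> : n + k%:Z + k%:Z = n + (2 * k)%N%:Z by lia.
have -> : n + (2 * k)%N%:Z + (2 * k)%N%:Z = n + (4 * k)%N%:Z by lia.
have -> : n + (2 * k)%N%:Z + k%:Z = n + (3 * k)%N%:Z by lia.
have -> : n + (3 * k)%N%:Z + (2 * k)%N%:Z = n + (5 * k)%N%:Z by lia.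
have -> : n + (3 * k)%N%:Z + k%:Z = n + (4 * k)%N%:Z by lia.
move: h0.
have := x_neq0 (n + (2 * k)%N%:Z); have := x_neq0 (n + (2 * k)%N%:Z + 1).
have := x_neq0 (n + (3 * k)%N%:Z); have := x_neq0 (n + (3 * k)%N%:Z + 1).
move: (x n) (x (n + 1)) (x (n + k%:Z)) (x (n + k%:Z + 1)).
move: (x (n + (2 * k)%N%:Z)) (x (n + (2 * k)%N%:Z + 1)).
move: (x (n + (3 * k)%N%:Z)) (x (n + (3 * k)%N%:Z + 1)).
move: (x (n + (4 * k)%N%:Z)) (x (n + (4 * k)%N%:Z + 1)).
move: (x (n + (5 * k)%N%:Z)) (x (n + (5 * k)%N%:Z + 1)).
(* Here [yi] is x_(n+ik) and [zi] is x_(n+ik+1). *)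
move=> y5 z5 y4 z4 y3 z3 y2 z2 y0 z0 y1 z1 nz3 ny3 nz2 ny2 h0 h1 h2 h3.
have first : y0 / y2 - z0 / z2 = a * (y1 + z1) / (y2 * z2).
  have -> : a * (y1 + z1) = z2 * y0 - y2 * z0 by rewrite h0; ring.
  by field; rewrite ny2 nz2.
have last : z5 / z3 - y5 / y3 = a * (y4 + z4) / (y3 * z3).
  have -> : a * (y4 + z4) = z5 * y3 - y5 * z3 by rewrite h3; ring.
  by field; rewrite ny3 nz3.
have middle : (z1 * z4 + a ^+ 2) / (z2 * z3) - (y1 * y4 + a ^+ 2) / (y2 * y3)
    = a * (y1 + z1) / (y2 * z2) - a * (y4 + z4) / (y3 * z3).
  have e1 : y3 * z1 = z3 * y1 - a * (y2 + z2) by rewrite h1; ring.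
  have e4 : z4 * y2 = y4 * z2 + a * (y3 + z3) by rewrite h2.
  apply/eqP; rewrite -subr_eq0; apply/eqP.
  (* Over the common denominator, z1 and z4 are grouped into y3 z1 and z4 y2; once [e1] and [e4]
     eliminate these, the numerator vanishes identically. *)
  transitivity (((y3 * z1) * (z4 * y2) + a ^+ 2 * (y2 * y3)
      - (y1 * y4 + a ^+ 2) * z2 * z3
      - a * z3 * (y1 * y3 + y3 * z1) + a * z2 * (y4 * y2 + z4 * y2))
      / (y2 * z2 * y3 * z3)).
    by field; rewrite ny2 nz2 ny3 nz3.
  rewrite e1 e4; apply/eqP; rewrite mulf_eq0; apply/orP; left; apply/eqP.
  by ring.
rewrite -(subrK ((y1 * y4 + a ^+ 2) / (y2 * y3)) (_ / (z2 * z3))) middle.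
rewrite -(subrK (y5 / y3) (z5 / z3)) last -(subKr (y0 / y2) (z0 / z2)) first.
by ring.
Qed.

Lemma reducedK_const m n : reducedK m = reducedK n.
Proof.
suff E i : reducedK i = reducedK 0 by rewrite !E.
elim/int_ind: i => // i IH.
  by rewrite -IH -[i.+1]addn1 PoszD reducedK_step.
by rewrite -IH -[LHS]reducedK_step; congr reducedK; lia.
Qed.

Lemma reducedK_linear n :
  x (n + (6 * k)%N%:Z)
    - reducedK n * (x (n + (4 * k)%N%:Z) - x (n + (2 * k)%N%:Z)) - x n = 0.
Proof.
have E := reducedK_const (n + k%:Z) n.
apply: (mulfI (x_neq0 (n + (3 * k)%N%:Z))).
(* By constancy the coefficient of x_(n+4k) can be taken at n + k and that of x_(n+2k) at n, so that
   each product clears its own denominators. *)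
transitivity (x (n + (3 * k)%N%:Z) * (x (n + (6 * k)%N%:Z) - x n)
   - (reducedK (n + k%:Z) * (x (n + (3 * k)%N%:Z) * x (n + (4 * k)%N%:Z))
      - reducedK n * (x (n + (2 * k)%N%:Z) * x (n + (3 * k)%N%:Z)))).
  by rewrite E; ring.
rewrite {E} /reducedK.
have -> : n + k%:Z + (2 * k)%N%:Z = n + (3 * k)%N%:Z by lia.
have -> : n + k%:Z + k%:Z = n + (2 * k)%N%:Z by lia.
have -> : n + k%:Z + (3 * k)%N%:Z = n + (4 * k)%N%:Z by lia.
have -> : n + k%:Z + (4 * k)%N%:Z = n + (5 * k)%N%:Z by lia.
have -> : n + k%:Z + (5 * k)%N%:Z = n + (6 * k)%N%:Z by lia.
by field; rewrite !x_neq0.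
Qed.

Let r n := x (n + (2 * k)%N%:Z) / x n.
Let s n := x n / x (n + (2 * k)%N%:Z).

Lemma ratio_step n :
  a * ((x (n + k%:Z) + x (n + k%:Z + 1)) / (x n * x (n + 1))) = r (n + 1) - r n.
Proof.
rewrite mulrA (_ : a * _ = x (n + (2 * k)%N%:Z + 1) * x n
  - x (n + (2 * k)%N%:Z) * x (n + 1)); last by rewrite x_rec; ring.
rewrite /r (_ : n + 1 + (2 * k)%N%:Z = n + (2 * k)%N%:Z + 1); last by ring.
by field; rewrite !x_neq0.
Qed.

(** The recurrence at n - k, divided by x_(n+k) x_(n+k+1). *)
Lemma inv_ratio_step n :
  a * ((x n + x (n + 1)) / (x (n + k%:Z) * x (n + k%:Z + 1)))
  = s (n - k%:Z) - s (n - k%:Z + 1).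
Proof.
have := x_rec (n - k%:Z); rewrite subrK /s.
rewrite (_ : n - k%:Z + 1 + (2 * k)%N%:Z = n + k%:Z + 1); last by lia.
rewrite (_ : n - k%:Z + (2 * k)%N%:Z = n + k%:Z); last by lia.
move=> h; rewrite mulrA (_ : a * _ = x (n + k%:Z + 1) * x (n - k%:Z)
  - x (n + k%:Z) * x (n - k%:Z + 1)); last by rewrite h; ring.
by field; rewrite !x_neq0.
Qed.

(** The upper limit is free because the sum occurs twice: up to k in [P1], and up to l as the inner
    sum of [P2]. *)
Lemma sum_ratio_step l :
  a * (\sum_(1 <= j < l.+1)
         (x (k%:Z + j%:Z - 1) + x (k%:Z + j%:Z)) / (x (j%:Z - 1) * x j))
  = r l - r 0.
Proof.
rewrite mulr_sumr big_add1 /= -(telescope_sumr (fun j : nat => r j)) //.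
apply: eq_bigr => j _.
rewrite -addn1 PoszD addrK -ratio_step.
by congr (a * ((x _ + x _) / _)); lia.
Qed.

Lemma sum_inv_ratio_step :
  a * (\sum_(1 <= j < k.+1)
         (x (j%:Z - 1) + x j) / (x (j%:Z + k%:Z - 1) * x (j%:Z + k%:Z)))
  = s (- k%:Z) - s 0.
Proof.
rewrite mulr_sumr big_add1 /=.
transitivity (- (s (k%:Z - k%:Z) - s (0%N%:Z - k%:Z))); last first.
  by rewrite subrr sub0r opprB.
rewrite -(telescope_sumr (fun j : nat => s (j%:Z - k%:Z))) // -sumrN.
apply: eq_bigr => j _; rewrite opprB.
rewrite -addn1 PoszD addrK (addrAC _ 1 (- k%:Z)) -inv_ratio_step.
by congr (a * (_ / (x _ * x _))); lia.
Qed.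

(* Factoring out 1/x_l, the recurrence turns
   (x_l + x_(l+1)) x_(l+2k) + a (x_(l+k) + x_(l+k+1))
   into x_l (x_(l+2k) + x_(l+2k+1)). *)
Lemma P2_term_step n :
  a ^+ 2 * (1 / x n * (1 / x (n + k%:Z) + 1 / x (n + k%:Z + 1)))
  + a * ((x n + x (n + 1)) / (x (n + k%:Z) * x (n + k%:Z + 1))) * r n
  = r (n + k%:Z + 1) - r (n + k%:Z).
Proof.
rewrite -ratio_step (_ : n + k%:Z + k%:Z = n + (2 * k)%N%:Z); last by lia.
transitivity (a * (x n * x (n + (2 * k)%N%:Z)
    + (x (n + (2 * k)%N%:Z) * x (n + 1)
       + a * (x (n + k%:Z) + x (n + k%:Z + 1))))
    / (x n * x (n + k%:Z) * x (n + k%:Z + 1))).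
  by rewrite /r; field; rewrite !x_neq0.
by rewrite -x_rec; field; rewrite !x_neq0.
Qed.

(** The inner sum collapses to r_l - r_0. Its r_l part combines with the single sum through
    [P2_term_step], and its r_0 part telescopes through [inv_ratio_step]. *)
Lemma P2_telescoped : (0 < k)%N ->
  a ^+ 2 * P2 k x
  = a ^+ 2 / (x k * x (2 * k)%N)
    + (r (2 * k)%N - r k) - r 0 * (s (- k%:Z) - s 0).
Proof.
move=> k_gt0.
(* For l = 0 the inner sum is empty, so the double sum may start at 0 like the single sum. *)
have extend (G : nat -> F) : G 0%N = 0 ->
    \sum_(1 <= l < k) G l = \sum_(0 <= l < k) G l.
  by move=> G0; rewrite [RHS]big_ltn // G0 add0r.
rewrite /P2 extend; last by rewrite big_geq.
rewrite -addrA -big_split /= mulrDr mulr_sumr mulrA mulr1 -addrA; congr (_ + _).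
transitivity (\sum_(0 <= l < k)
  ((r (l.+1%:Z + k%:Z) + r 0 * s (l.+1%:Z - k%:Z))
   - (r (l%:Z + k%:Z) + r 0 * s (l%:Z - k%:Z)))); last first.
  rewrite (telescope_sumr (fun l : nat => r (l%:Z + k%:Z) + r 0 * s (l%:Z - k%:Z))) //.
  rewrite subrr add0r sub0r (_ : k%:Z + k%:Z = (2 * k)%N); last by lia.
  by ring.
apply: eq_bigr => l _.
have inner : a ^+ 2 * (\sum_(1 <= m < l.+1)
      ((x l + x (l%:Z + 1)) * (x (k%:Z + m%:Z - 1) + x (k%:Z + m%:Z)))
      / (x (k%:Z + l%:Z) * x (k%:Z + l%:Z + 1) * x (m%:Z - 1) * x m))
  = a * ((x l + x (l%:Z + 1)) / (x (l%:Z + k%:Z) * x (l%:Z + k%:Z + 1)))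
    * (r l - r 0).
  rewrite -sum_ratio_step !mulr_sumr; apply: eq_bigr => m _.
  by rewrite (addrC k%:Z l%:Z); field; rewrite !x_neq0.
rewrite mulrDr inner mulrBr addrA P2_term_step inv_ratio_step.
rewrite -addn1 PoszD.
rewrite (addrAC _ 1 k%:Z) (addrAC _ 1 (- k%:Z)).
by ring.
Qed.

(** The products r_0 (s_(-k) - s_0) from [P1] and [P2] cancel. Since r_0 s_0 = 1, what remains is
    s_(-k) + r_(2k) + s_0 r_k + a^2 / (x_k x_(2k)). *)
Lemma Kinv_reducedK : (0 < k)%N -> Kinv k a x = reducedK (- k%:Z).
Proof.
move=> k_gt0; rewrite /Kinv P2_telescoped //.
have -> : a * P1 k x = (1 + x (2 * k)%N / x 0) * (s (- k%:Z) - s 0)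
    + (1 + x 0 / x (2 * k)%N) * (r k - r 0).
  rewrite -sum_inv_ratio_step -sum_ratio_step /P1 mulrDr !(mulrCA a).
  congr (_ + _ * (_ * _)); apply: eq_bigr => j _.
  by rewrite (addrC k%:Z).
rewrite /P0 /reducedK /r /s !add0r.
have -> : - k%:Z + (2 * k)%N%:Z = k by lia.
have -> : - k%:Z + (5 * k)%N%:Z = (4 * k)%N by lia.
have -> : - k%:Z + (3 * k)%N%:Z = (2 * k)%N by lia.
have -> : - k%:Z + (4 * k)%N%:Z = (3 * k)%N by lia.
have -> : - k%:Z + k%:Z = 0 by lia.
have -> : (2 * k)%N%:Z + (2 * k)%N%:Z = (4 * k)%N by lia.
have -> : k%:Z + (2 * k)%N%:Z = (3 * k)%N by lia.
by field; rewrite !x_neq0.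
Qed.

End LinearRelation.

Theorem theorem1p3 (R : realType) (k : nat) (hk : (1 <= k)%N) (n : int) :
  let x : int -> ratF R k := xseq R k in
  let K : ratF R k := Kinv k (param R k) x in
  x (n + (6 * k)%N%:Z) - K * (x (n + (4 * k)%N%:Z) - x (n + (2 * k)%N%:Z)) - x n
    = 0.
Proof.
move=> x K.
have x0 m : x m != 0 by exact: xseq_neq0.
have xr m := @xseq_rec R k m hk.
rewrite /K (Kinv_reducedK _ _ _ _ x0 xr hk).
(* Constancy moves the base point from -k to n. *)
rewrite (reducedK_const _ _ _ _ x0 xr _ n).
exact: reducedK_linear.
Qed.
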